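(* Let $R$ be a regular (commutative Noetherian) ring of prime characteristic $p$. Let $\mathcal{M}$ be an $F$-finite $F$-module over $R$ with generating morphism $\alpha:M\to F(M)$, where $M$ is a finitely generated $R$-module, and let $\mathcal{N}$ be a second $F$-finite $F$-module over $R$ with generating morphism $\beta:N\to F(N)$, where $N$ is a finitely generated $R$-module. Then $\mathcal{M}\otimes_R\mathcal{N}$ is an $F$-finite $F$-module with generating morphism $$\gamma:=\Delta\circ(\alpha\otimes\beta):M\otimes_RN\longrightarrow F(M\otimes_RN),$$ where $\Delta:F(M)\otimes_RF(N)\xrightarrow{\cong}F(M\otimes_RN)$ is the $R$-isomorphism for which $\Delta((r'\otimes x)\otimes(s'\otimes y))=r's'\otimes(x\otimes y)$ for all $r',s'\in R'$, $x\in M$, $y\in N$.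
   Context: $F$ denotes the Frobenius functor $R'\otimes_R\bullet$, where $R'$ is $R$ regarded as a left $R$-module naturally and as a right $R$-module via the Frobenius homomorphism $r\mapsto r^p$ (so $r'\otimes rm=r'r^p\otimes m$). An $F$-module is an $R$-module $\mathcal{M}$ equipped with an $R$-isomorphism $\mathcal{M}\to F(\mathcal{M})$, its structure isomorphism. For an $R$-homomorphism $\beta:M\to F(M)$, let $\mathcal{N}$ be the direct limit of $M\xrightarrow{\beta}F(M)\xrightarrow{F(\beta)}F^2(M)\to\cdots$; the maps $F^i(\beta)$ induce an isomorphism $\mathcal{N}\to F(\mathcal{N})$ (as $F$ commutes with direct limits), making $\mathcal{N}$ an $F$-module, and $\beta$ is called a generating morphism for (any $F$-module isomorphic to) $\mathcal{N}$. An $F$-module is $F$-finite if it has a generating morphism $L\to F(L)$ with $L$ a finitely generated $R$-module. *)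

(* Defs.v *)
From HB Require Import structures.
From mathcomp Require Import all_boot all_order all_algebra.
From mathcomp Require Import generic_quotient ring_quotient.
From mathcomp Require Import boolp.
From mathcomp Require Import freeg ring.

Set Implicit Arguments.
Unset Strict Implicit.
Unset Printing Implicit Defensive.

Import GRing.Theory.
Local Open Scope ring_scope.
Local Open Scope quotient_scope.

Section Span.
Variables (R : nzRingType) (V : lmodType R) (S : V -> Prop).

Definition submod_span : {pred V} := fun v =>
  `[< forall Q : {pred V}, submod_closed Q -> (forall w, S w -> w \in Q) -> v \in Q >].

Lemma submod_spanP v :
  reflect (forall Q : {pred V}, submod_closed Q -> (forall w, S w -> w \in Q) -> v \in Q)
          (v \in submod_span).
Proof. exact: asboolP. Qed.

Lemma submod_span_closed : submod_closed submod_span.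
Proof.
split; first by apply/submod_spanP => Q [].
move=> a u v /submod_spanP hu /submod_spanP hv; apply/submod_spanP => Q cQ sQ.
by case: (cQ) => _; apply; [exact: hu | exact: hv].
Qed.

HB.instance Definition _ :=
  GRing.isSubmodClosed.Build R V submod_span submod_span_closed.

HB.instance Definition _ := GRing.isZmodClosed.Build V submod_span
  (GRing.submod_closedB submod_span_closed).

Lemma mem_submod_span v : S v -> v \in submod_span.
Proof. by move=> Sv; apply/submod_spanP => Q _; apply. Qed.

End Span.

Section QuotModule.
Variables (R : nzRingType) (V : lmodType R) (S : V -> Prop).
Let I : zmodClosed V := submod_span S.

Definition quotmod : Type := Quotient.quot I.
HB.instance Definition _ := GRing.Zmodule.on quotmod.
Definition quotmod_pi (v : V) : quotmod := \pi_(Quotient.quot I) v.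
Definition quotmod_scale (a : R) (x : quotmod) : quotmod :=
  quotmod_pi (a *: repr (x : Quotient.quot I)).

Lemma quotmod_eqP u v : reflect (quotmod_pi u = quotmod_pi v) (u - v \in submod_span S).
Proof. by rewrite Quotient.idealrBE; exact: eqP. Qed.

Lemma quotmod_piK (x : quotmod) : exists v, x = quotmod_pi v.
Proof. by exists (repr (x : Quotient.quot I)); rewrite /quotmod_pi reprK. Qed.

Lemma quotmod_piD u v : quotmod_pi (u + v) = quotmod_pi u + quotmod_pi v.
Proof. by rewrite /quotmod_pi piE. Qed.

Lemma quotmod_scaleE a v : quotmod_scale a (quotmod_pi v) = quotmod_pi (a *: v).
Proof.
apply/quotmod_eqP; rewrite -scalerBr rpredZ //; apply/quotmod_eqP.
by rewrite /quotmod_pi reprK.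
Qed.

Fact quotmod_scaleA a b x :
  quotmod_scale a (quotmod_scale b x) = quotmod_scale (a * b) x.
Proof. by have [v ->] := quotmod_piK x; rewrite !quotmod_scaleE scalerA. Qed.
Fact quotmod_scale1 : left_id 1 quotmod_scale.
Proof. by move=> x; have [v ->] := quotmod_piK x; rewrite quotmod_scaleE scale1r. Qed.
Fact quotmod_scaleDr : right_distributive quotmod_scale +%R.
Proof.
move=> a x y; have [u ->] := quotmod_piK x; have [v ->] := quotmod_piK y.
by rewrite -quotmod_piD !quotmod_scaleE scalerDr quotmod_piD.
Qed.
Fact quotmod_scaleDl x : {morph quotmod_scale^~ x : a b / a + b}.
Proof.
move=> a b; have [v ->] := quotmod_piK x.
by rewrite !quotmod_scaleE scalerDl quotmod_piD.
Qed.
HB.instance Definition _ := GRing.Zmodule_isLmodule.Build R quotmod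
  quotmod_scaleA quotmod_scale1 quotmod_scaleDr quotmod_scaleDl.

Lemma quotmod_pi_linear : linear quotmod_pi.
Proof. by move=> a u v; rewrite quotmod_piD -quotmod_scaleE. Qed.
HB.instance Definition _ := GRing.isLinear.Build R V quotmod _ quotmod_pi quotmod_pi_linear.

Section Lift.
Variables (W : lmodType R) (f : {linear V -> W}).
Hypothesis f0 : forall v, v \in submod_span S -> f v = 0.
Definition quotmod_lift (x : quotmod) : W := f (repr (x : Quotient.quot I)).
Lemma quotmod_liftE v : quotmod_lift (quotmod_pi v) = f v.
Proof.
apply/eqP; rewrite -subr_eq0 -linearB; apply/eqP/f0/quotmod_eqP.
by rewrite /quotmod_pi reprK.
Qed.
Lemma quotmod_lift_linear : linear quotmod_lift.
Proof.
move=> a x y; have [u ->] := quotmod_piK x; have [v ->] := quotmod_piK y.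
by rewrite -linearP !quotmod_liftE linearP.
Qed.
End Lift.

End QuotModule.

Section FreeLift.
Variables (R : nzRingType) (K : choiceType) (M : lmodType R) (f : K -> M).

Lemma freeg_scaleU (c k : R) (x : K) : c *: << k *g x >> = << c * k *g x >> :> {freeg K / R}.
Proof. by apply/eqP/freeg_eqP => y; rewrite coeffZ !coeffU mulrA. Qed.

Lemma fglift_linear : linear (fglift f : {freeg K / R} -> M).
Proof.
pose F : {freeg K / R} -> M := fglift f.
have FB : zmod_morphism F := lift_is_additive f.
pose Fm := GRing.isZmodMorphism.Build _ _ F FB.
pose G : {additive {freeg K / R} -> M} := HB.pack F Fm.
move=> a u v; rewrite -[fglift f]/(G : _ -> _) raddfD; congr (_ + _).
rewrite -[u]freeg_sumE scaler_sumr !raddf_sum.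
by apply: eq_bigr => z _; rewrite freeg_scaleU /= /F !liftU scalerA.
Qed.
HB.instance Definition _ :=
  GRing.isLinear.Build R {freeg K / R} M _ (fglift f) fglift_linear.
End FreeLift.

Section Tensor.
Variables (R : comNzRingType) (M N : lmodType R).

Local Notation free := {freeg (M * N)%type / R}.

Inductive tensor_rel : free -> Prop :=
| TensorRelL a x x' y : tensor_rel (<< (a *: x + x', y) >> - a *: << (x, y) >> - << (x', y) >>)
| TensorRelR a x y y' : tensor_rel (<< (x, a *: y + y') >> - a *: << (x, y) >> - << (x, y') >>).

Definition tensor : Type := quotmod tensor_rel.
HB.instance Definition _ := GRing.Lmodule.on tensor.

Definition tens (x : M) (y : N) : tensor := quotmod_pi _ << (x, y) >>.

Lemma tens_linearl y : linear (tens^~ y).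
Proof.
move=> a x x'; rewrite /tens -linearP; apply/quotmod_eqP.
by rewrite opprD addrA; apply/mem_submod_span/TensorRelL.
Qed.

Lemma tens_linearr x : linear (tens x).
Proof.
move=> a y y'; rewrite /tens -linearP; apply/quotmod_eqP.
by rewrite opprD addrA; apply/mem_submod_span/TensorRelR.
Qed.

Lemma tensDl x x' y : tens (x + x') y = tens x y + tens x' y.
Proof. by have := tens_linearl y 1 x x'; rewrite !scale1r. Qed.
Lemma tensDr x y y' : tens x (y + y') = tens x y + tens x y'.
Proof. by have := tens_linearr x 1 y y'; rewrite !scale1r. Qed.
Lemma tens0l y : tens 0 y = 0.
Proof. by apply: (addrI (tens 0 y)); rewrite -tensDl !addr0. Qed.
Lemma tens0r x : tens x 0 = 0.
Proof. by apply: (addrI (tens x 0)); rewrite -tensDr !addr0. Qed.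
Lemma tensZl a x y : tens (a *: x) y = a *: tens x y.
Proof. by have := tens_linearl y a x 0; rewrite tens0l !addr0. Qed.
Lemma tensZr a x y : tens x (a *: y) = a *: tens x y.
Proof. by have := tens_linearr x a y 0; rewrite tens0r !addr0. Qed.

Lemma tensor_ind (P : tensor -> Prop) :
  P 0 -> (forall u v, P u -> P v -> P (u + v)) -> (forall x y, P (tens x y)) ->
  forall t, P t.
Proof.
move=> P0 PD Pt t; have [v ->] := quotmod_piK t.
rewrite -[v]freeg_sumE linear_sum; elim/big_ind: _ => // [[x y]] _.
rewrite -[coeff _ _]mulr1 -freeg_scaleU linearZ /=.
by rewrite -[quotmod_pi _ _]/(tens x y) -tensZl.
Qed.

Section Lift.
Variables (P : lmodType R) (b : M -> N -> P).
Hypotheses (bl : forall y, linear (b^~ y)) (br : forall x, linear (b x)).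

Let f (z : M * N) : P := b z.1 z.2.
(* The linearity proofs are arguments only so that [tensor_lift bl br] is
   canonically linear. *)
Definition tensor_lift (_ : forall y, linear (b^~ y)) (_ : forall x, linear (b x))
  : tensor -> P := quotmod_lift (fglift f).

Let flin0 v : v \in submod_span tensor_rel -> fglift f v = 0.
Proof.
move/submod_spanP => /(_ (fun w => fglift f w == 0)) H; apply/eqP/H.
  split; first by rewrite unfold_in linear0.
  by move=> a u w; rewrite !unfold_in linearP /= => /eqP -> /eqP ->; rewrite scaler0 addr0.
have fU z : fglift f << z >> = f z by rewrite liftU scale1r.
move=> _ [a x x' y|a x y y']; rewrite unfold_in !linearB linearZ /= !fU /f /=.
  by rewrite (bl y) -addrA -opprD subrr.
by rewrite (br x) -addrA -opprD subrr.
Qed.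

Lemma tensor_liftE x y : tensor_lift bl br (tens x y) = b x y.
Proof. by rewrite /tensor_lift quotmod_liftE; [rewrite /= liftU scale1r | exact: flin0]. Qed.

Fact tensor_lift_linear : linear (tensor_lift bl br).
Proof. by apply: quotmod_lift_linear; exact: flin0. Qed.
HB.instance Definition _ :=
  GRing.isLinear.Build R tensor P _ (tensor_lift bl br) tensor_lift_linear.
End Lift.
End Tensor.

Section TensorMap.
Variables (R : comNzRingType) (M M' N N' : lmodType R).
Variables (f : {linear M -> M'}) (g : {linear N -> N'}).

Fact tensor_map_linl y : linear (fun x => tens (f x) (g y)).
Proof. by move=> a x x'; rewrite linearP tensDl tensZl. Qed.
Fact tensor_map_linr x : linear (fun y => tens (f x) (g y)).
Proof. by move=> a y y'; rewrite linearP tensDr tensZr. Qed.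

Definition tensor_map : tensor M N -> tensor M' N' :=
  tensor_lift tensor_map_linl tensor_map_linr.
HB.instance Definition _ := GRing.Linear.on tensor_map.

Lemma tensor_mapE x y : tensor_map (tens x y) = tens (f x) (g y).
Proof. exact: tensor_liftE. Qed.
End TensorMap.

(* Restriction of scalars along r |-> r ^+ p. *)
Definition frob_res (R : comNzRingType) (p : nat) (hp : p \in [pchar R])
  (V : lmodType R) : Type := V.

Section FrobRes.
Variables (R : comNzRingType) (p : nat) (hp : p \in [pchar R]) (V : lmodType R).
Local Notation frob_res := (frob_res hp).
HB.instance Definition _ := GRing.Zmodule.on (frob_res V).
Definition frob_res_scale (a : R) (x : frob_res V) : frob_res V := (a ^+ p *: (x : V) : V).
Fact frob_res_scaleA a b x :
  frob_res_scale a (frob_res_scale b x) = frob_res_scale (a * b) x.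
Proof. by rewrite /frob_res_scale scalerA exprMn. Qed.
Fact frob_res_scale1 : left_id 1 frob_res_scale.
Proof. by move=> x; rewrite /frob_res_scale expr1n scale1r. Qed.
Fact frob_res_scaleDr : right_distributive frob_res_scale +%R.
Proof. by move=> a x y; exact: scalerDr. Qed.
Fact frob_res_scaleDl x : {morph frob_res_scale^~ x : a b / a + b}.
Proof.
move=> a b; rewrite /frob_res_scale -!(pFrobenius_autE hp).
by rewrite pFrobenius_autD_comm ?scalerDl //; exact: mulrC.
Qed.
HB.instance Definition _ := GRing.Zmodule_isLmodule.Build R (frob_res V)
  frob_res_scaleA frob_res_scale1 frob_res_scaleDr frob_res_scaleDl.
End FrobRes.

(* [frobR] is the bimodule R' seen through its right R-module structure
   x . r = x * r ^+ p, which [tensor] contracts; [frob M] carries the R-module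
   structure coming from the left structure r . x = r * x of R'. *)
Definition frobR (R : comNzRingType) (p : nat) (hp : p \in [pchar R]) : lmodType R :=
  frob_res hp R^o.

Definition frob (R : comNzRingType) (p : nat) (hp : p \in [pchar R])
  (M : lmodType R) : Type := tensor (frobR hp) M.

Section FrobModule.
Variables (R : comNzRingType) (p : nat) (hp : p \in [pchar R]) (M : lmodType R).

HB.instance Definition _ := GRing.Zmodule.on (frob hp M).

Definition ftens (r : R) (x : M) : frob hp M := @tens R (frobR hp) M r x.

Definition frobR_mul (a : R) : frobR hp -> frobR hp := fun r : R => a * r.
Fact frobR_mul_linear a : linear (frobR_mul a).
Proof.
move=> b x y; rewrite /frobR_mul.
have -> : b *: x + y = (b ^+ p * x + y : R) by [].
by rewrite mulrDr mulrCA.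
Qed.
HB.instance Definition _ a :=
  GRing.isLinear.Build R (frobR hp) (frobR hp) _ (frobR_mul a) (frobR_mul_linear a).

Definition frob_scale (a : R) : frob hp M -> frob hp M := tensor_map (frobR_mul a) idfun.

Lemma ftensDl r s x : ftens (r + s) x = ftens r x + ftens s x.
Proof. exact: tensDl. Qed.
Lemma ftensDr r x y : ftens r (x + y) = ftens r x + ftens r y.
Proof. exact: tensDr. Qed.
Lemma ftensZr r a x : ftens r (a *: x) = ftens (r * a ^+ p) x.
Proof. by rewrite mulrC /ftens tensZr -tensZl. Qed.

Lemma frob_ind (P : frob hp M -> Prop) :
  P 0 -> (forall u v, P u -> P v -> P (u + v)) -> (forall r x, P (ftens r x)) ->
  forall t, P t.
Proof. exact: tensor_ind. Qed.

Lemma frob_scale_ftens a r x : frob_scale a (ftens r x) = ftens (a * r) x.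
Proof. exact: tensor_mapE. Qed.
Fact frob_scaleDr : right_distributive frob_scale +%R.
Proof. by move=> a u v; exact: linearD. Qed.
Fact frob_scale0 a : frob_scale a 0 = 0.
Proof. exact: linear0. Qed.
Fact frob_scaleA a b u : frob_scale a (frob_scale b u) = frob_scale (a * b) u.
Proof.
elim/frob_ind: u => [|u v IHu IHv|r x]; first by rewrite !frob_scale0.
  by rewrite !frob_scaleDr IHu IHv.
by rewrite !frob_scale_ftens mulrA.
Qed.
Fact frob_scale1 : left_id 1 frob_scale.
Proof.
elim/frob_ind => [|u v IHu IHv|r x]; first by rewrite !frob_scale0.
  by rewrite !frob_scaleDr IHu IHv.
by rewrite !frob_scale_ftens mul1r.
Qed.
Fact frob_scaleDl u : {morph frob_scale^~ u : a b / a + b}.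
Proof.
move=> a b /=; elim/frob_ind: u => [|u v IHu IHv|r x]; first by rewrite !frob_scale0 addr0.
  by rewrite !frob_scaleDr IHu IHv addrACA.
by rewrite !frob_scale_ftens mulrDl ftensDl.
Qed.
HB.instance Definition _ := GRing.Zmodule_isLmodule.Build R (frob hp M)
  frob_scaleA frob_scale1 frob_scaleDr frob_scaleDl.

Lemma ftensZl a r x : ftens (a * r) x = a *: ftens r x.
Proof. by rewrite -frob_scale_ftens. Qed.
Lemma ftens1 r x : ftens r x = r *: ftens 1 x.
Proof. by rewrite -ftensZl mulr1. Qed.

Section Lift.
Variables (P : lmodType R) (g : {linear M -> frob_res hp P}).

Definition frob_lift_map (r : R) (x : M) : frob_res hp P := r *: (g x : P).

Fact frob_lift_linl x : linear (fun r : frobR hp => frob_lift_map r x).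
Proof.
move=> a r s; rewrite /frob_lift_map.
have -> : a *: r + s = (a ^+ p * r + s : R) by [].
by rewrite scalerDl -scalerA.
Qed.
Fact frob_lift_linr (r : frobR hp) : linear (fun x => frob_lift_map r x).
Proof.
move=> a x y; rewrite /frob_lift_map linearP.
have -> : a *: g x + g y = (a ^+ p *: (g x : P) + (g y : P) : P) by [].
by rewrite scalerDr scalerA mulrC -scalerA.
Qed.
Definition frob_lift : frob hp M -> P := tensor_lift frob_lift_linl frob_lift_linr.

Lemma frob_liftE r x : frob_lift (ftens r x) = r *: (g x : P).
Proof. exact: (tensor_liftE frob_lift_linl frob_lift_linr). Qed.
Fact frob_liftD u v : frob_lift (u + v) = frob_lift u + frob_lift v.
Proof. exact: (linearD (tensor_lift frob_lift_linl frob_lift_linr)). Qed.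
Fact frob_lift0 : frob_lift 0 = 0.
Proof. exact: (linear0 (tensor_lift frob_lift_linl frob_lift_linr)). Qed.
Fact frob_lift_linear : linear frob_lift.
Proof.
move=> a u v; rewrite frob_liftD; congr (_ + _).
elim/frob_ind: u => [|{}u w IHu IHw|r x]; first by rewrite scaler0 frob_lift0 scaler0.
  by rewrite scalerDr !frob_liftD scalerDr IHu IHw.
by rewrite -ftensZl !frob_liftE scalerA.
Qed.
HB.instance Definition _ :=
  GRing.isLinear.Build R (frob hp M) P _ frob_lift frob_lift_linear.
End Lift.
End FrobModule.

Section FrobMap.
Variables (R : comNzRingType) (p : nat) (hp : p \in [pchar R]).

Definition frob_map (M N : lmodType R) (f : {linear M -> N}) : frob hp M -> frob hp N :=
  tensor_map (idfun : {linear frobR hp -> frobR hp}) f.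

Section Map.
Variables (M N : lmodType R) (f : {linear M -> N}).
Lemma frob_mapE r x : frob_map f (ftens hp r x) = ftens hp r (f x).
Proof. exact: tensor_mapE. Qed.
Fact frob_mapD u v : frob_map f (u + v) = frob_map f u + frob_map f v.
Proof. exact: (linearD (tensor_map (idfun : {linear frobR hp -> frobR hp}) f)). Qed.
Fact frob_map0 : frob_map f 0 = 0.
Proof. exact: (linear0 (tensor_map (idfun : {linear frobR hp -> frobR hp}) f)). Qed.
Fact frob_map_linear : linear (frob_map f).
Proof.
move=> a u v; rewrite frob_mapD; congr (_ + _).
elim/frob_ind: u => [|{}u w IHu IHw|r x]; first by rewrite scaler0 frob_map0 scaler0.
  by rewrite scalerDr !frob_mapD scalerDr IHu IHw.
by rewrite -ftensZl !frob_mapE ftensZl.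
Qed.
HB.instance Definition _ :=
  GRing.isLinear.Build R (frob hp M) (frob hp N) _ (frob_map f) frob_map_linear.
End Map.

Lemma frob_linear_ext (M P : lmodType R) (f g : {linear frob hp M -> P}) :
  (forall x, f (ftens hp 1 x) = g (ftens hp 1 x)) -> f =1 g.
Proof.
move=> fg; elim/frob_ind => [|u v IHu IHv|r x]; first by rewrite !linear0.
  by rewrite !linearD IHu IHv.
by rewrite ftens1 !linearZ fg.
Qed.

Lemma frob_map_comp (M N P : lmodType R) (f : {linear M -> N}) (g : {linear N -> P}) :
  frob_map (g \o f) =1 frob_map g \o frob_map f.
Proof. by apply: frob_linear_ext => x; rewrite /= !frob_mapE. Qed.

Lemma eq_frob_map (M N : lmodType R) (f g : {linear M -> N}) :
  f =1 g -> frob_map f =1 frob_map g.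
Proof. by move=> fg; apply: frob_linear_ext => x; rewrite /= !frob_mapE fg. Qed.
End FrobMap.
Arguments frob_map {R p} hp {M N} f.

Section Delta.
Variables (R : comNzRingType) (p : nat) (hp : p \in [pchar R]) (M N : lmodType R).

Local Notation F := (frob hp).
Local Notation res := (frob_res hp).

Section DeltaL.
Variable x : M.
Definition Delta_gen (y : N) : res (F (tensor M N)) := ftens hp 1 (tens x y).
Fact Delta_gen_linear : linear Delta_gen.
Proof.
by move=> a y y'; rewrite /Delta_gen tensDr tensZr ftensDr ftensZr mul1r (ftens1 hp (a ^+ p)).
Qed.
HB.instance Definition _ :=
  GRing.isLinear.Build R N (res (F (tensor M N))) _ Delta_gen Delta_gen_linear.
Definition Delta_r : F N -> F (tensor M N) := frob_lift Delta_gen.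
HB.instance Definition _ := GRing.Linear.on Delta_r.
Lemma Delta_rE s y : Delta_r (ftens hp s y) = ftens hp s (tens x y).
Proof. by rewrite /Delta_r frob_liftE ftens1. Qed.
End DeltaL.

Section DeltaR.
Variable v : F N.
Definition Delta_r_at (x : M) : res (F (tensor M N)) := Delta_r x v.
Fact Delta_r_at_linear : linear Delta_r_at.
Proof.
move=> a x x'.
suff : Delta_r (a *: x + x') v = a ^+ p *: Delta_r x v + Delta_r x' v by [].
elim/frob_ind: v => [|u w IHu IHw|s y]; first by rewrite !linear0 ?scaler0 addr0.
  by rewrite ![Delta_r _ (u + w)]linearD /= IHu IHw scalerDr addrACA.
by rewrite !Delta_rE tensDl tensZl ftensDr ftensZr mulrC ftensZl.
Qed.
HB.instance Definition _ :=
  GRing.isLinear.Build R M (res (F (tensor M N))) _ Delta_r_at Delta_r_at_linear.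
Definition Delta_lr : F M -> F (tensor M N) := frob_lift Delta_r_at.
HB.instance Definition _ := GRing.Linear.on Delta_lr.
Lemma Delta_lrE r x : Delta_lr (ftens hp r x) = r *: Delta_r x v.
Proof. exact: frob_liftE. Qed.
End DeltaR.

Fact Delta_linearl v : linear (Delta_lr v).
Proof. by move=> a u u'; rewrite linearP. Qed.
Fact Delta_linearr u : linear (Delta_lr^~ u).
Proof.
move=> a v v' /=; elim/frob_ind: u => [|u w IHu IHw|r x].
- by rewrite !linear0 ?scaler0 addr0.
- by rewrite ![Delta_lr _ (u + w)]linearD /= IHu IHw scalerDr addrACA.
by rewrite !Delta_lrE linearP scalerDr !scalerA mulrC.
Qed.

Definition Delta : tensor (F M) (F N) -> F (tensor M N) :=
  tensor_lift (b := fun u v => Delta_lr v u) Delta_linearl Delta_linearr.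
HB.instance Definition _ := GRing.Linear.on Delta.

Lemma DeltaE r x s y :
  Delta (tens (ftens hp r x) (ftens hp s y)) = ftens hp (r * s) (tens x y).
Proof. by rewrite /Delta tensor_liftE Delta_lrE Delta_rE ftensZl. Qed.

Definition Delta_inv_gen (x : M) (y : N) : res (tensor (F M) (F N)) :=
  tens (ftens hp 1 x) (ftens hp 1 y).
Fact Delta_inv_linl y : linear (Delta_inv_gen^~ y).
Proof.
move=> a x x'; rewrite /Delta_inv_gen ftensDr ftensZr mul1r tensDl.
by rewrite (ftens1 hp (a ^+ p)) tensZl.
Qed.
Fact Delta_inv_linr x : linear (Delta_inv_gen x).
Proof.
move=> a y y'; rewrite /Delta_inv_gen ftensDr ftensZr mul1r tensDr.
by rewrite (ftens1 hp (a ^+ p)) tensZr.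
Qed.
Definition Delta_inv : F (tensor M N) -> tensor (F M) (F N) :=
  frob_lift (tensor_lift Delta_inv_linl Delta_inv_linr).
HB.instance Definition _ := GRing.Linear.on Delta_inv.

Lemma Delta_invE r x y :
  Delta_inv (ftens hp r (tens x y)) = r *: tens (ftens hp 1 x) (ftens hp 1 y).
Proof. by rewrite /Delta_inv frob_liftE /= tensor_liftE. Qed.

Lemma Delta_bij : bijective Delta.
Proof.
exists Delta_inv => t.
  elim/tensor_ind: t => [|t t' IHt IHt'|u v]; first by rewrite !linear0.
    by rewrite !linearD /= IHt IHt'.
  elim/frob_ind: u => [|u w IHu IHw|r x]; first by rewrite tens0l !linear0.
    by rewrite tensDl !linearD /= IHu IHw.
  elim/frob_ind: v => [|u w IHu IHw|s y]; first by rewrite tens0r !linear0.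
    by rewrite tensDr !linearD /= IHu IHw.
  by rewrite DeltaE Delta_invE [ftens hp r x]ftens1 [ftens hp s y]ftens1 tensZl tensZr scalerA.
elim/frob_ind: t => [|t t' IHt IHt'|r t]; first by rewrite !linear0.
  by rewrite !linearD /= IHt IHt'.
elim/tensor_ind: t => [|u v IHu IHv|x y].
- by rewrite /ftens tens0r !linear0.
- by rewrite ftensDr !linearD /= IHu IHv.
by rewrite Delta_invE linearZ /= DeltaE mulr1 -ftens1.
Qed.
End Delta.
Arguments Delta {R p} hp M N.

(* Direct limit of L 0 -> L 1 -> L 2 -> ..., as a quotient of the disjoint union. *)
Section DirLim.
Variables (R : nzRingType) (L : nat -> lmodType R) (f : forall i, {linear L i -> L i.+1}).

(* The transition map L i -> L k when i <= k (and 0 when k < i). *)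
Fixpoint dl_trans (i k : nat) : L i -> L k :=
  match i =P k with
  | ReflectT e => fun x => ecast j (L j) e x
  | ReflectF _ =>
    match k return L i -> L k with
    | 0%N => fun _ => 0
    | k'.+1 => fun x => f k' (@dl_trans i k' x)
    end
  end.
Arguments dl_trans : clear implicits.

Lemma dl_trans_id i x : dl_trans i i x = x.
Proof. by case: i x => [|i] x /=; case: eqP => // e; rewrite eq_axiomK. Qed.

Lemma dl_transS i k x : (i <= k)%N -> dl_trans i k.+1 x = f k (dl_trans i k x).
Proof. by move=> le_ik /=; case: eqP => // e; exfalso; move: le_ik; rewrite e ltnn. Qed.

Lemma dl_trans_trans i j k x :
  (i <= j)%N -> (j <= k)%N -> dl_trans j k (dl_trans i j x) = dl_trans i k x.
Proof.
move=> le_ij /subnKC <-; elim: (k - j)%N => [|n IHn]; first by rewrite addn0 dl_trans_id.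
by rewrite addnS !dl_transS ?IHn ?leq_addr // (leq_trans le_ij) ?leq_addr.
Qed.

Lemma dl_trans_linear i k : linear (@dl_trans i k).
Proof.
have [le_ik|lt_ki] := leqP i k.
  rewrite -(subnKC le_ik); elim: (k - i)%N => [|n IHn] a x y.
    by rewrite addn0 !dl_trans_id.
  by rewrite addnS !dl_transS ?leq_addr // IHn linearP.
suff t0 x : dl_trans i k x = 0 by move=> a x y; rewrite !t0 scaler0 addr0.
elim: k lt_ki => [|k IHk] lt_ki /=; case: eqP => // e.
- by exfalso; move: lt_ki; rewrite e.
- by exfalso; move: lt_ki; rewrite e ltnn.
by rewrite IHk ?linear0 // ltnW.
Qed.
HB.instance Definition _ i k :=
  GRing.isLinear.Build R (L i) (L k) _ (@dl_trans i k) (@dl_trans_linear i k).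

Definition dl_equiv (u v : {i : nat & L i}) : bool :=
  `[< exists k, [/\ (tag u <= k)%N, (tag v <= k)%N
                 & dl_trans (tag u) k (tagged u) = dl_trans (tag v) k (tagged v)] >].

Fact dl_equiv_class : equiv_class_of dl_equiv.
Proof.
split=> [u|u v|v u w].
- by apply/asboolP; exists (tag u).
- by apply/asboolP/asboolP => -[k [? ? ?]]; exists k.
move=> /asboolP [k [uk vk e]] /asboolP [l [vl wl e']]; apply/asboolP.
exists (maxn k l); split; rewrite ?leq_max ?uk ?wl ?orbT //.
rewrite -(dl_trans_trans _ uk (leq_maxl k l)) e dl_trans_trans ?leq_maxl //.
by rewrite -(dl_trans_trans _ wl (leq_maxr k l)) -e' dl_trans_trans ?leq_maxr.
Qed.
Canonical dl_equiv_rel := EquivRelPack dl_equiv_class.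
Canonical dl_encModRel := defaultEncModRel dl_equiv.

Definition dirlim : Type := {eq_quot dl_equiv}.
HB.instance Definition _ := Choice.on dirlim.

Definition dl_in (i : nat) (x : L i) : dirlim :=
  \pi_({eq_quot dl_equiv}) (Tagged (fun i => L i : Type) x).

Lemma dl_inP i j (x : L i) (y : L j) :
  dl_in x = dl_in y <->
  exists k, [/\ (i <= k)%N, (j <= k)%N & dl_trans i k x = dl_trans j k y].
Proof.
split=> [/eqmodP /asboolP //|h].
by apply/eqmodP/asboolP.
Qed.

Lemma dl_in_trans i k (x : L i) : (i <= k)%N -> dl_in (dl_trans i k x) = dl_in x.
Proof. by move=> le_ik; apply/dl_inP; exists k; rewrite dl_trans_id. Qed.

Lemma dl_in_f i (x : L i) : dl_in (f i x) = dl_in x.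
Proof. by rewrite -(@dl_in_trans i i.+1) // dl_transS // dl_trans_id. Qed.

Lemma dl_in_surj (z : dirlim) : exists i (x : L i), z = dl_in x.
Proof.
exists (tag (repr (z : {eq_quot dl_equiv}))), (tagged (repr (z : {eq_quot dl_equiv}))).
by rewrite /dl_in taggedK reprK.
Qed.

Definition dl_lift_op (W : Type) (g : forall i, L i -> W) (z : dirlim) : W :=
  g _ (tagged (repr (z : {eq_quot dl_equiv}))).

Lemma dl_lift_opE (W : Type) (g : forall i, L i -> W) :
  (forall i x, g i.+1 (f i x) = g i x) ->
  forall i (x : L i), dl_lift_op g (dl_in x) = g i x.
Proof.
move=> gf i x.
have gt j k (y : L j) : (j <= k)%N -> g k (dl_trans j k y) = g j y.
  move/subnKC <-; elim: (k - j)%N => [|n IHn]; first by rewrite addn0 dl_trans_id.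
  by rewrite addnS dl_transS ?leq_addr // gf.
have : dl_in (tagged (repr (dl_in x : {eq_quot dl_equiv}))) = dl_in x.
  by rewrite {1}/dl_in taggedK reprK.
by case/dl_inP => k [jk ik e]; rewrite -(gt _ _ _ ik) -e gt.
Qed.

Definition dl_add (z w : dirlim) : dirlim :=
  dl_lift_op (fun i x => dl_lift_op (fun j y =>
    dl_in (dl_trans i (maxn i j) x + dl_trans j (maxn i j) y)) w) z.

Lemma dl_in_add i j k (x : L i) (y : L j) : (i <= k)%N -> (j <= k)%N ->
  dl_in (dl_trans i (maxn i j) x + dl_trans j (maxn i j) y) =
  dl_in (dl_trans i k x + dl_trans j k y).
Proof.
move=> ik jk; have mk : (maxn i j <= k)%N by rewrite geq_max ik.
by rewrite -(dl_in_trans _ mk) linearD /= !dl_trans_trans ?leq_maxl ?leq_maxr.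
Qed.

Lemma dl_addE i (x y : L i) : dl_add (dl_in x) (dl_in y) = dl_in (x + y).
Proof.
have fl j k (u : L j) (v : L k) :
    dl_in (dl_trans j (maxn j k.+1) u + dl_trans k.+1 (maxn j k.+1) (f k v)) =
    dl_in (dl_trans j (maxn j k) u + dl_trans k (maxn j k) v).
  rewrite (@dl_in_add j k (maxn j k.+1)) ?leq_maxl //; last first.
    by rewrite leq_max leqnSn orbT.
  congr (dl_in (_ + _)); rewrite -(@dl_trans_trans k k.+1) ?leq_maxr //.
  by rewrite dl_transS // dl_trans_id.
rewrite /dl_add dl_lift_opE; last first.
  move=> j u; rewrite /dl_lift_op; set v := repr _.
  rewrite addrC [RHS](_ : _ = dl_in (dl_trans (tag v) (maxn (tag v) j) (tagged v)
    + dl_trans j (maxn (tag v) j) u)); last by rewrite addrC maxnC.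
  by rewrite -fl maxnC.
rewrite dl_lift_opE; last by move=> k v; exact: fl.
by rewrite maxnn !dl_trans_id.
Qed.

Definition dl_scale (a : R) (z : dirlim) : dirlim :=
  dl_lift_op (fun i x => dl_in (a *: x)) z.
Lemma dl_scaleE a i (x : L i) : dl_scale a (dl_in x) = dl_in (a *: x).
Proof.
by rewrite /dl_scale dl_lift_opE // => j y; rewrite -[RHS]dl_in_f linearZ.
Qed.

Lemma dl_in0 i : dl_in (0 : L i) = dl_in (0 : L 0%N).
Proof. by rewrite -(dl_in_trans (0 : L 0%N) (leq0n i)) linear0. Qed.

Lemma dl_in_surj2 (z w : dirlim) :
  exists i (x y : L i), z = dl_in x /\ w = dl_in y.
Proof.
have [i [x ->]] := dl_in_surj z; have [j [y ->]] := dl_in_surj w.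
exists (maxn i j), (dl_trans i _ x), (dl_trans j _ y).
by rewrite !dl_in_trans ?leq_maxl ?leq_maxr.
Qed.

Fact dl_addA : associative dl_add.
Proof.
move=> z w v; have [i [x [y [-> ->]]]] := dl_in_surj2 z w.
have [j [t ->]] := dl_in_surj v.
rewrite -(dl_in_trans x (leq_maxl i j)) -(dl_in_trans y (leq_maxl i j)).
by rewrite -(dl_in_trans t (leq_maxr i j)) !dl_addE addrA.
Qed.
Fact dl_addC : commutative dl_add.
Proof.
by move=> z w; have [i [x [y [-> ->]]]] := dl_in_surj2 z w; rewrite !dl_addE addrC.
Qed.
Fact dl_add0 : left_id (dl_in (0 : L 0%N)) dl_add.
Proof.
by move=> z; have [i [x ->]] := dl_in_surj z; rewrite -(dl_in0 i) dl_addE add0r.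
Qed.
Fact dl_addN : left_inverse (dl_in (0 : L 0%N)) (dl_scale (-1)) dl_add.
Proof.
move=> z; have [i [x ->]] := dl_in_surj z.
by rewrite dl_scaleE dl_addE scaleN1r addNr dl_in0.
Qed.
HB.instance Definition _ :=
  GRing.isZmodule.Build dirlim dl_addA dl_addC dl_add0 dl_addN.

Fact dl_scaleA a b z : dl_scale a (dl_scale b z) = dl_scale (a * b) z.
Proof. by have [i [x ->]] := dl_in_surj z; rewrite !dl_scaleE scalerA. Qed.
Fact dl_scale1 : left_id 1 dl_scale.
Proof. by move=> z; have [i [x ->]] := dl_in_surj z; rewrite dl_scaleE scale1r. Qed.
Fact dl_scaleDr : right_distributive dl_scale +%R.
Proof.
move=> a z w; have [i [x [y [-> ->]]]] := dl_in_surj2 z w.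
by rewrite -[_ + _]/(dl_add _ _) dl_addE !dl_scaleE scalerDr -dl_addE.
Qed.
Fact dl_scaleDl z : {morph dl_scale^~ z : a b / a + b}.
Proof.
move=> a b; have [i [x ->]] := dl_in_surj z.
by rewrite !dl_scaleE scalerDl -dl_addE.
Qed.
HB.instance Definition _ := GRing.Zmodule_isLmodule.Build R dirlim
  dl_scaleA dl_scale1 dl_scaleDr dl_scaleDl.

Fact dl_in_linear i : linear (@dl_in i).
Proof. by move=> a x y; rewrite -dl_addE -dl_scaleE. Qed.
HB.instance Definition _ i :=
  GRing.isLinear.Build R (L i) dirlim _ (@dl_in i) (@dl_in_linear i).

Section Lift.
Variables (W : lmodType R) (g : forall i, {linear L i -> W}).
Definition dl_lift (_ : forall i x, g i.+1 (f i x) = g i x) : dirlim -> W :=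
  dl_lift_op g.
Hypothesis gf : forall i x, g i.+1 (f i x) = g i x.
Lemma dl_liftE i (x : L i) : dl_lift gf (dl_in x) = g i x.
Proof. exact: (dl_lift_opE gf). Qed.
Fact dl_lift_linear : linear (dl_lift gf).
Proof.
move=> a z w; have [i [x [y [-> ->]]]] := dl_in_surj2 z w.
by rewrite -linearP !dl_liftE linearP.
Qed.
HB.instance Definition _ :=
  GRing.isLinear.Build R dirlim W _ (dl_lift gf) dl_lift_linear.
End Lift.
End DirLim.

Section FModules.
Variables (R : comNzRingType) (p : nat) (hp : p \in [pchar R]).
Local Notation F := (frob hp).

Record fmodule := FModule {
  fmod_car :> lmodType R;
  fmod_str : {linear fmod_car -> F fmod_car};
  fmod_str_bij : bijective fmod_str }.

Definition fmod_iso (MM NN : fmodule) : Prop :=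
  exists phi : {linear MM -> NN},
    bijective phi /\ forall x, fmod_str NN (phi x) = frob_map hp phi (fmod_str MM x).

Definition fin_gen (M : lmodType R) : Prop :=
  exists s : seq M, forall x : M,
  exists c : 'I_(size s) -> R, x = \sum_(i < size s) c i *: s`_i.

Section Generated.
Variables (M : lmodType R) (beta : {linear M -> F M}).

Fixpoint frob_iter (i : nat) : lmodType R :=
  if i is i'.+1 then F (frob_iter i') else M.

Fixpoint frob_iter_map (i : nat) : {linear frob_iter i -> frob_iter i.+1} :=
  match i return {linear frob_iter i -> frob_iter i.+1} with
  | 0%N => beta
  | i'.+1 => frob_map hp (frob_iter_map i')
  end.

Definition gen_lim : lmodType R := dirlim frob_iter_map.

Definition gen_in (i : nat) : {linear frob_iter i -> gen_lim} := @dl_in R frob_iter frob_iter_map i.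

Definition gen_str_at (i : nat) : {linear frob_iter i -> F gen_lim} :=
  frob_map hp (gen_in i) \o frob_iter_map i.

Lemma gen_in_f i x : gen_in i.+1 (frob_iter_map i x) = gen_in i x.
Proof. exact: dl_in_f. Qed.

Lemma gen_in_surj (t : gen_lim) : exists i (x : frob_iter i), t = gen_in i x.
Proof. exact: dl_in_surj. Qed.

Fact gen_str_compat i x : gen_str_at i.+1 (frob_iter_map i x) = gen_str_at i x.
Proof.
rewrite /= -[LHS]/((frob_map hp (gen_in i.+1) \o frob_map hp (frob_iter_map i)) _).
rewrite -frob_map_comp; apply: eq_frob_map => y; exact: gen_in_f.
Qed.

Definition gen_str : {linear gen_lim -> F gen_lim} := dl_lift gen_str_compat.

Lemma gen_strE i x : gen_str (gen_in i x) = frob_map hp (gen_in i) (frob_iter_map i x).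
Proof. exact: (dl_liftE gen_str_compat). Qed.

Section Inv.
Variable i : nat.
Definition gen_inv_at (x : frob_iter i) : frob_res hp gen_lim :=
  gen_in i.+1 (ftens hp 1 x).
Fact gen_inv_at_linear : linear gen_inv_at.
Proof.
move=> a x y; rewrite /gen_inv_at ftensDr ftensZr mul1r ftens1.
exact: (linearP (gen_in i.+1)).
Qed.
HB.instance Definition _ := GRing.isLinear.Build R (frob_iter i) (frob_res hp gen_lim) _
  gen_inv_at gen_inv_at_linear.
End Inv.

Fact gen_inv_compat i x : gen_inv_at (frob_iter_map i x) = gen_inv_at x.
Proof. by rewrite /gen_inv_at -frob_mapE; exact: (gen_in_f (i := i.+1)). Qed.

Definition gen_inv : {linear F gen_lim -> gen_lim} :=
  frob_lift (dl_lift (g := fun i => gen_inv_at (i := i)) gen_inv_compat).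

Lemma gen_invE r i x : gen_inv (ftens hp r (gen_in i x)) = gen_in i.+1 (ftens hp r x).
Proof.
rewrite [LHS]frob_liftE.
have e : dl_lift (g := fun i => gen_inv_at (i := i)) gen_inv_compat (gen_in i x) =
  gen_inv_at x by exact: dl_liftE.
rewrite [ftens hp r x]ftens1 linearZ /= -[X in _ = _ *: X]/(gen_inv_at x : gen_lim) -e.
by [].
Qed.

Lemma gen_str_bij : bijective gen_str.
Proof.
exists gen_inv => t.
  have [i [x ->]] := gen_in_surj t.
  rewrite gen_strE -gen_in_f.
  elim/frob_ind: (frob_iter_map i x) => [|u v IHu IHv|r y]; first by rewrite !linear0.
    by rewrite !linearD /= IHu IHv.
  by rewrite frob_mapE gen_invE.
elim/frob_ind: t => [|u v IHu IHv|r t]; first by rewrite !linear0.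
  by rewrite !linearD /= IHu IHv.
have [i [x ->]] := gen_in_surj t; rewrite gen_invE gen_strE /=.
by rewrite !frob_mapE gen_in_f.
Qed.

Definition gen_fmod : fmodule := FModule gen_str_bij.
End Generated.

Definition generating_morphism (MM : fmodule) (M : lmodType R) (beta : {linear M -> F M}) : Prop :=
  fmod_iso (gen_fmod beta) MM.

Definition F_finite (MM : fmodule) : Prop :=
  exists (L : lmodType R) (beta : {linear L -> F L}),
    fin_gen L /\ generating_morphism MM beta.

Section TensorFMod.
Variables MM NN : fmodule.

Definition fmod_tensor_str : {linear tensor MM NN -> F (tensor MM NN)} :=
  Delta hp MM NN \o tensor_map (fmod_str MM) (fmod_str NN).

Lemma fmod_tensor_str_bij : bijective fmod_tensor_str.
Proof.
apply: bij_comp; first exact: Delta_bij.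
have [g fK gK] := fmod_str_bij MM; have [g' fK' gK'] := fmod_str_bij NN.
pose gl : {linear F MM -> MM} := HB.pack g (GRing.isLinear.Build _ _ _ _ g (can2_linear fK gK)).
pose gl' : {linear F NN -> NN} := HB.pack g' (GRing.isLinear.Build _ _ _ _ g' (can2_linear fK' gK')).
by exists (tensor_map gl gl') => t;
  elim/tensor_ind: t => [|u v IHu IHv|x y]; rewrite ?linear0 // ?linearD /= ?IHu ?IHv //;
  rewrite !tensor_mapE /= ?fK ?fK' ?gK ?gK'.
Qed.

Definition fmod_tensor : fmodule := FModule fmod_tensor_str_bij.
End TensorFMod.
End FModules.

Section Localization.
Variables (R : comNzRingType) (P : prime_idealr R).

Definition loc_den : Type := {s : R | s \notin (P : pred R)}.
HB.instance Definition _ := Choice.on loc_den.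

Fact loc_den_mul_subproof (s t : loc_den) : sval s * sval t \notin (P : pred R).
Proof. by rewrite prime_idealrM negb_or (svalP s) (svalP t). Qed.
Definition loc_den_mul (s t : loc_den) : loc_den := exist (fun r => is_true (r \notin (P : pred R))) _ (loc_den_mul_subproof s t).
Fact loc_den1_subproof : 1 \notin (P : pred R).
Proof. by rewrite idealr1. Qed.
Definition loc_den1 : loc_den := exist (fun r => is_true (r \notin (P : pred R))) _ loc_den1_subproof.

Definition loc_equiv (u v : R * loc_den) : bool :=
  `[< exists t : loc_den, sval t * (u.1 * sval v.2 - v.1 * sval u.2) = 0 >].

Fact loc_equiv_class : equiv_class_of loc_equiv.
Proof.
split=> [u|u v|v u w].
- by apply/asboolP; exists loc_den1; rewrite subrr mulr0.
- by apply/asboolP/asboolP => -[t e]; exists t; rewrite -opprB mulrN e oppr0.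
move=> /asboolP [t e] /asboolP [t' e']; apply/asboolP.
exists (loc_den_mul v.2 (loc_den_mul t t')) => /=.
transitivity ((sval t' * sval w.2) * (sval t * (u.1 * sval v.2 - v.1 * sval u.2))
   + (sval t * sval u.2) * (sval t' * (v.1 * sval w.2 - w.1 * sval v.2))); first by ring.
by rewrite e e' !mulr0 addr0.
Qed.
Canonical loc_equiv_rel := EquivRelPack loc_equiv_class.
Canonical loc_encModRel := defaultEncModRel loc_equiv.

Definition localization : Type := {eq_quot loc_equiv}.
HB.instance Definition _ := Choice.on localization.

Definition loc_frac (a : R) (s : loc_den) : localization :=
  \pi_({eq_quot loc_equiv}) (a, s).
Definition loc_num (z : localization) : R := (repr (z : {eq_quot loc_equiv})).1.
Definition loc_denom (z : localization) : loc_den := (repr (z : {eq_quot loc_equiv})).2.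

Lemma loc_fracP a s b t :
  loc_frac a s = loc_frac b t <->
  exists x : loc_den, sval x * (a * sval t - b * sval s) = 0.
Proof.
split=> [/eqmodP /asboolP //|h].
by apply/eqmodP/asboolP.
Qed.

Lemma loc_frac_repr z : z = loc_frac (loc_num z) (loc_denom z).
Proof. by rewrite /loc_frac -surjective_pairing reprK. Qed.

Lemma loc_frac_numden a s :
  exists x : loc_den, sval x *
    (loc_num (loc_frac a s) * sval s - a * sval (loc_denom (loc_frac a s))) = 0.
Proof. by apply/loc_fracP; rewrite -loc_frac_repr. Qed.

Definition loc_add (z w : localization) : localization :=
  loc_frac (loc_num z * sval (loc_denom w) + loc_num w * sval (loc_denom z))
           (loc_den_mul (loc_denom z) (loc_denom w)).
Definition loc_mul (z w : localization) : localization :=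
  loc_frac (loc_num z * loc_num w) (loc_den_mul (loc_denom z) (loc_denom w)).
Definition loc_opp (z : localization) : localization :=
  loc_frac (- loc_num z) (loc_denom z).

Lemma loc_addE a s b t :
  loc_add (loc_frac a s) (loc_frac b t) =
  loc_frac (a * sval t + b * sval s) (loc_den_mul s t).
Proof.
have [x ex] := loc_frac_numden a s; have [y ey] := loc_frac_numden b t.
apply/loc_fracP; exists (loc_den_mul x y).
move: ex ey; move: (loc_num _) (loc_denom _) (loc_num _) (loc_denom _) => b' t' a' s' ex ey /=.
transitivity ((sval y * sval t * sval t') * (sval x * (a' * sval s - a * sval s'))
   + (sval x * sval s * sval s') * (sval y * (b' * sval t - b * sval t'))); first by ring.
by rewrite ex ey !mulr0 addr0.
Qed.

Lemma loc_mulE a s b t :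
  loc_mul (loc_frac a s) (loc_frac b t) = loc_frac (a * b) (loc_den_mul s t).
Proof.
have [x ex] := loc_frac_numden a s; have [y ey] := loc_frac_numden b t.
apply/loc_fracP; exists (loc_den_mul x y).
move: ex ey; move: (loc_num _) (loc_denom _) (loc_num _) (loc_denom _) => b' t' a' s' ex ey /=.
transitivity ((sval y * sval t * b') * (sval x * (a' * sval s - a * sval s'))
   + (sval x * a * sval s') * (sval y * (b' * sval t - b * sval t'))); first by ring.
by rewrite ex ey !mulr0 addr0.
Qed.

Lemma loc_oppE a s : loc_opp (loc_frac a s) = loc_frac (- a) s.
Proof.
have [x ex] := loc_frac_numden a s; apply/loc_fracP; exists x.
by rewrite !mulNr -opprD mulrN ex oppr0.
Qed.

Lemma eq_loc_frac a s b t : a * sval t = b * sval s -> loc_frac a s = loc_frac b t.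
Proof. by move=> e; apply/loc_fracP; exists loc_den1; rewrite e subrr mulr0. Qed.

Fact loc_addA : associative loc_add.
Proof.
move=> x y z; rewrite (loc_frac_repr x) (loc_frac_repr y) (loc_frac_repr z) !loc_addE.
by apply: eq_loc_frac => /=; ring.
Qed.
Fact loc_addC : commutative loc_add.
Proof. by move=> x y; apply: eq_loc_frac => /=; ring. Qed.
Fact loc_add0 : left_id (loc_frac 0 loc_den1) loc_add.
Proof.
by move=> x; rewrite (loc_frac_repr x) loc_addE; apply: eq_loc_frac => /=; ring.
Qed.
Fact loc_addN : left_inverse (loc_frac 0 loc_den1) loc_opp loc_add.
Proof.
move=> x; rewrite (loc_frac_repr x) loc_oppE loc_addE.
by apply: eq_loc_frac => /=; ring.
Qed.
HB.instance Definition _ :=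
  GRing.isZmodule.Build localization loc_addA loc_addC loc_add0 loc_addN.

Fact loc_mulA : associative loc_mul.
Proof.
move=> x y z; rewrite (loc_frac_repr x) (loc_frac_repr y) (loc_frac_repr z) !loc_mulE.
by apply: eq_loc_frac => /=; ring.
Qed.
Fact loc_mulC : commutative loc_mul.
Proof. by move=> x y; apply: eq_loc_frac => /=; ring. Qed.
Fact loc_mul1 : left_id (loc_frac 1 loc_den1) loc_mul.
Proof.
by move=> x; rewrite (loc_frac_repr x) loc_mulE; apply: eq_loc_frac => /=; ring.
Qed.
Fact loc_mulDl : left_distributive loc_mul +%R.
Proof.
move=> x y z; rewrite -![_ + _]/(loc_add _ _).
rewrite (loc_frac_repr x) (loc_frac_repr y) (loc_frac_repr z) !(loc_mulE, loc_addE).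
by apply: eq_loc_frac => /=; ring.
Qed.
Fact loc_1neq0 : loc_frac 1 loc_den1 != 0.
Proof.
apply/eqP => /loc_fracP [x /=]; rewrite mulr1 mul0r subr0 mulr1 => x0.
by have := svalP x; rewrite x0 (idealr0 P).
Qed.
HB.instance Definition _ := GRing.Zmodule_isComNzRing.Build localization
  loc_mulA loc_mulC loc_mul1 loc_mulDl loc_1neq0.
End Localization.

Section Regular.
Variable A : comNzRingType.

Definition ideal_gen (I : {pred A}) (s : seq A) : Prop :=
  forall x, x \in I <-> exists c : 'I_(size s) -> A, x = \sum_(i < size s) c i * s`_i.

(* Ideals are the submodules of A^o; the [idealr]s are the proper ones. *)
Definition noetherian_ring : Prop :=
  forall I : {pred A^o}, submod_closed I -> exists s : seq A, ideal_gen I s.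

Definition maximal_ideal (m : idealr A) : Prop :=
  forall J : idealr A, {subset (m : {pred A}) <= (J : {pred A})} -> 
    {subset (J : {pred A}) <= (m : {pred A})}.

Definition prime_chain (n : nat) (Q : nat -> prime_idealr A) : Prop :=
  forall i, (i < n)%N -> {subset (Q i : {pred A}) <= (Q i.+1 : {pred A})} /\
    ~ {subset (Q i.+1 : {pred A}) <= (Q i : {pred A})}.

Definition krull_dim (d : nat) : Prop :=
  (exists Q, prime_chain d Q) /\ (forall n Q, prime_chain n Q -> (n <= d)%N).

Definition regular_local_ring : Prop :=
  noetherian_ring /\
  exists m : idealr A,
    [/\ maximal_ideal m,
        forall m' : idealr A, maximal_ideal m' -> (m' : {pred A}) =i (m : {pred A})
      & exists s, ideal_gen m s /\ krull_dim (size s)].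
End Regular.

Definition regular_ring (R : comNzRingType) : Prop :=
  noetherian_ring R /\ forall P : prime_idealr R, regular_local_ring (localization P).

(* Main.v *)
(** The isomorphism Delta is natural, so iterating it yields isomorphisms
    D_i : F^i(M) (x) F^i(N) -> F^i(M (x) N) that carry the transition maps
    F^i(alpha) (x) F^i(beta) to F^i(gamma).  Since tensor products commute with
    direct limits, the limit generated by gamma is the tensor product of the
    limits generated by alpha and beta, compatibly with the structure maps. *)
From HB Require Import structures.
Require Import Defs.
From mathcomp Require Import all_boot all_order all_algebra.
From mathcomp Require Import boolp.

Set Implicit Arguments.
Unset Strict Implicit.
Unset Printing Implicit Defensive.

Import GRing.Theory.
Local Open Scope ring_scope.

(** * Linear inverses, finite generation and functoriality of tensor products *)

(** [bijective] supplies only a bare function as inverse; maps out of tensor products and limits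
    must be built from linear ones. *)
Lemma linear_bij_inv (R : nzRingType) (U V : lmodType R) (f : {linear U -> V}) :
  bijective f -> exists g : {linear V -> U}, cancel f g /\ cancel g f.
Proof.
case=> g fK gK.
pose gl : {linear V -> U} := HB.pack g (GRing.isLinear.Build _ _ _ _ g (can2_linear fK gK)).
by exists gl.
Qed.

(** The products of generators generate: their combinations [P] form a submodule, and a pure tensor
    expands bilinearly into it. *)
Lemma fin_gen_tensor (R : comNzRingType) (M N : lmodType R) :
  fin_gen M -> fin_gen N -> fin_gen (tensor M N).
Proof.
move=> [s hs] [t ht].
pose l : seq (tensor M N) := [seq tens x y | x <- s, y <- t].
pose P v := exists c : 'I_(size l) -> R, v = \sum_(i < size l) c i *: l`_i.
have P0 : P 0 by exists (fun=> 0); rewrite big1 // => i _; rewrite scale0r.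
have PD u v : P u -> P v -> P (u + v).
  move=> [c ->] [d ->]; exists (fun i => c i + d i).
  by rewrite -big_split; apply: eq_bigr => i _; rewrite scalerDl.
have PZ a v : P v -> P (a *: v).
  move=> [c ->]; exists (fun i => a * c i).
  by rewrite scaler_sumr; apply: eq_bigr => i _; rewrite scalerA.
have Pl v : v \in l -> P v.
  move=> vl; have lt_v : (index v l < size l)%N by rewrite index_mem.
  (* Kronecker coefficients at the first occurrence of [v], since [l] may contain repetitions. *)
  exists (fun i => (i == Ordinal lt_v)%:R).
  rewrite (bigD1 (Ordinal lt_v)) //= eqxx scale1r nth_index // big1 ?addr0 //.
  by move=> i /negbTE ->; rewrite scale0r.
exists l; elim/tensor_ind => [|//|x y]; first exact: P0.
have [c ->] := hs x; have [d ->] := ht y.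
have -> : tens (\sum_(i < size s) c i *: s`_i) (\sum_(j < size t) d j *: t`_j) =
    \sum_(i < size s) \sum_(j < size t) c i *: (d j *: tens s`_i t`_j).
  rewrite (big_morph (fun x => tens x _) (fun x x' => tensDl x x' _) (tens0l _ _)).
  apply: eq_bigr => i _.
  rewrite (big_morph (tens _) (fun y y' => tensDr _ y y') (tens0r _ _)).
  by apply: eq_bigr => j _; rewrite tensZl tensZr.
elim/big_ind: _ => // i _; elim/big_ind: _ => // j _.
by apply/PZ/PZ/Pl/allpairs_f; apply: mem_nth.
Qed.

Lemma eq_tensor_linear (R : comNzRingType) (M N P : lmodType R)
  (f g : {linear tensor M N -> P}) :
  (forall x y, f (tens x y) = g (tens x y)) -> f =1 g.
Proof.
move=> fg; elim/tensor_ind => [|u v IHu IHv|//]; first by rewrite !linear0.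
by rewrite !linearD IHu IHv.
Qed.

Lemma tensor_map_comp (R : comNzRingType) (M M' M'' N N' N'' : lmodType R)
  (f : {linear M -> M'}) (f' : {linear M' -> M''})
  (g : {linear N -> N'}) (g' : {linear N' -> N''}) t :
  tensor_map f' g' (tensor_map f g t) = tensor_map (f' \o f) (g' \o g) t.
Proof.
move: t; apply: (@eq_tensor_linear R M N (tensor M'' N'') (tensor_map f' g' \o tensor_map f g)
  (tensor_map (f' \o f) (g' \o g))).
by move=> x y; rewrite /= !tensor_mapE.
Qed.

Lemma eq_tensor_map (R : comNzRingType) (M M' N N' : lmodType R)
  (f f' : {linear M -> M'}) (g g' : {linear N -> N'}) :
  f =1 f' -> g =1 g' -> tensor_map f g =1 tensor_map f' g'.
Proof.
move=> ff' gg'; apply: (@eq_tensor_linear R M N (tensor M' N') (tensor_map f g)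
  (tensor_map f' g')).
by move=> x y; rewrite /= !tensor_mapE ff' gg'.
Qed.

Lemma tensor_map_id (R : comNzRingType) (M N : lmodType R)
  (f : {linear M -> M}) (g : {linear N -> N}) :
  f =1 id -> g =1 id -> tensor_map f g =1 id.
Proof.
move=> fE gE; apply: (@eq_tensor_linear R M N (tensor M N) (tensor_map f g) idfun).
by move=> x y; rewrite /= tensor_mapE fE gE.
Qed.

(** * Bilinear maps out of a pair of direct limits *)

Section DirLimTensor.
Variables (R : comNzRingType) (L L' : nat -> lmodType R).
Variables (f : forall i, {linear L i -> L i.+1}) (f' : forall i, {linear L' i -> L' i.+1}).

Lemma dl_in_common (z : dirlim f) (w : dirlim f') :
  exists i (x : L i) (y : L' i), z = dl_in f x /\ w = dl_in f' y.
Proof.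
have [i [x ->]] := dl_in_surj z; have [j [y ->]] := dl_in_surj w.
exists (maxn i j), (dl_trans f (maxn i j) x), (dl_trans f' (maxn i j) y).
by rewrite !dl_in_trans ?leq_maxl ?leq_maxr.
Qed.

(* Every pair of elements comes from a common index, where the value is forced;
   so the bilinear map can be obtained by unique choice. *)
Lemma dl_tensor_lift (W : lmodType R) (g : forall i, {linear tensor (L i) (L' i) -> W}) :
  (forall i x y, g i.+1 (tens (f i x) (f' i y)) = g i (tens x y)) ->
  exists h : {linear tensor (dirlim f) (dirlim f') -> W},
  forall i x y, h (tens (dl_in f x) (dl_in f' y)) = g i (tens x y).
Proof.
move=> gf.
have gt i k x y : (i <= k)%N -> g k (tens (dl_trans f k x) (dl_trans f' k y)) = g i (tens x y).
  move/subnKC <-; elim: (k - i)%N => [|n IHn]; first by rewrite addn0 !dl_trans_id.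
  by rewrite addnS !dl_transS ?leq_addr // gf.
have ex z w : exists t, forall i (x : L i) (y : L' i),
    z = dl_in f x -> w = dl_in f' y -> t = g i (tens x y).
  have [i [x [y [-> ->]]]] := dl_in_common z w; exists (g i (tens x y)).
  (* The two representatives of [z] agree at stage [k], those of [w] at stage [l]; both pairs agree
     at [maxn k l], where [gt] compares the values. *)
  move=> j x' y' /dl_inP [k [ik jk exx]] /dl_inP [l [il jl eyy]].
  have km := leq_maxl k l; have lm := leq_maxr k l.
  rewrite -(gt i (maxn k l)) ?(leq_trans ik) // -(gt j (maxn k l)) ?(leq_trans jk) //.
  rewrite -(dl_trans_trans f x ik km) exx dl_trans_trans //.
  by rewrite -(dl_trans_trans f' y il lm) eyy dl_trans_trans.
pose b z w := sval (cid (ex z w)).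
have bE i x y : b (dl_in f x) (dl_in f' y) = g i (tens x y).
  by rewrite /b; case: cid => t /=; apply.
have bl w : linear (b^~ w).
  move=> a z z'; have [i [x [x' [-> ->]]]] := dl_in_surj2 z z'.
  have [j [y ->]] := dl_in_surj w.
  rewrite -(dl_in_trans f x (leq_maxl i j)) -(dl_in_trans f x' (leq_maxl i j)).
  rewrite -(dl_in_trans f' y (leq_maxr i j)) -linearP !bE.
  by rewrite tensDl tensZl linearP.
have br z : linear (b z).
  move=> a w w'; have [i [y [y' [-> ->]]]] := dl_in_surj2 w w'.
  have [j [x ->]] := dl_in_surj z.
  rewrite -(dl_in_trans f' y (leq_maxl i j)) -(dl_in_trans f' y' (leq_maxl i j)).
  rewrite -(dl_in_trans f x (leq_maxr i j)) -linearP !bE.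
  by rewrite tensDr tensZr linearP.
by exists (tensor_lift bl br) => i x y; rewrite /= tensor_liftE bE.
Qed.
End DirLimTensor.

(** * Naturality of [Delta] and transport of isomorphisms through [F] and tensor products *)

Section FrobTensor.
Variables (R : comNzRingType) (p : nat) (hp : p \in [pchar R]).
Local Notation F := (frob hp).

(** By additivity it suffices to take [ftens r x] and [ftens s y], which both sides send to
    [ftens (r * s)] of [tens (f x) (g y)]. *)
Lemma Delta_natural (M M' N N' : lmodType R) (f : {linear M -> M'}) (g : {linear N -> N'}) u :
  Delta hp M' N' (tensor_map (frob_map hp f : {linear F M -> F M'})
                             (frob_map hp g : {linear F N -> F N'}) u) =
  frob_map hp (tensor_map f g) (Delta hp M N u).
Proof.
move: u.
pose Ff : {linear F M -> F M'} := frob_map hp f.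
pose Fg : {linear F N -> F N'} := frob_map hp g.
apply: (@eq_tensor_linear R (F M) (F N) (F (tensor M' N'))
  (Delta hp M' N' \o tensor_map Ff Fg) (frob_map hp (tensor_map f g) \o Delta hp M N)).
elim/frob_ind => [|u w IHu IHw|r x] v; first by rewrite tens0l !linear0.
  by rewrite tensDl !linearD IHu IHw.
elim/frob_ind: v => [|u w IHu IHw|s y]; first by rewrite tens0r !linear0.
  by rewrite tensDr !linearD IHu IHw.
rewrite /= tensor_mapE.
rewrite -[Ff _]/(frob_map hp f _) -[Fg _]/(frob_map hp g _) !frob_mapE !DeltaE.
by rewrite frob_mapE /= tensor_mapE.
Qed.

(** The induction step for [Delta_iter_natural]: [F] applied to a commuting square, pasted to the
    naturality square of [Delta]. *)
Lemma frob_Delta_square (M M' N N' P P' : lmodType R) (f : {linear M -> M'})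
  (g : {linear N -> N'}) (h : {linear P -> P'})
  (d : {linear tensor M N -> P}) (d' : {linear tensor M' N' -> P'}) :
  (forall t, d' (tensor_map f g t) = h (d t)) -> forall t,
  frob_map hp d' (Delta hp M' N' (tensor_map (frob_map hp f : {linear F M -> F M'})
                                             (frob_map hp g : {linear F N -> F N'}) t)) =
  frob_map hp h (frob_map hp d (Delta hp M N t)).
Proof.
move=> sq t; rewrite Delta_natural.
rewrite -[LHS]/((frob_map hp d' \o frob_map hp (tensor_map f g)) _) -frob_map_comp.
rewrite -[RHS]/((frob_map hp h \o frob_map hp d) _) -frob_map_comp.
exact: eq_frob_map.
Qed.

Lemma frob_map_id (M : lmodType R) (f : {linear M -> M}) : f =1 id -> frob_map hp f =1 id.
Proof.
move=> fE; apply: (@frob_linear_ext R p hp M (F M) (frob_map hp f) idfun) => x.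
by rewrite /= frob_mapE fE.
Qed.

Lemma frob_map_can (M N : lmodType R) (f : {linear M -> N}) (g : {linear N -> M}) :
  cancel f g -> cancel (frob_map hp f) (frob_map hp g).
Proof.
by move=> fK t; rewrite -[LHS]/((frob_map hp g \o frob_map hp f) t) -frob_map_comp frob_map_id.
Qed.

Lemma frob_map_bij (M N : lmodType R) (f : {linear M -> N}) :
  bijective f -> bijective (frob_map hp f).
Proof.
by case/linear_bij_inv => g [fK gK]; exists (frob_map hp g); apply: frob_map_can.
Qed.

Lemma tensor_map_bij (M M' N N' : lmodType R) (f : {linear M -> M'}) (g : {linear N -> N'}) :
  bijective f -> bijective g -> bijective (tensor_map f g).
Proof.
case/linear_bij_inv => f' [fK fK'] /linear_bij_inv [g' [gK gK']].
by exists (tensor_map f' g') => t; rewrite tensor_map_comp tensor_map_id.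
Qed.

Lemma fmod_iso_trans (A B C : fmodule hp) : fmod_iso A B -> fmod_iso B C -> fmod_iso A C.
Proof.
move=> [f [fb fF]] [g [gb gF]]; exists (g \o f); split; first exact: bij_comp.
by move=> x; rewrite /= gF fF -[LHS]/((frob_map hp g \o frob_map hp f) _) -frob_map_comp.
Qed.

(** Naturality moves [f] and [g] past [Delta]; what remains is compatibility with the structure maps
    in each factor. *)
Lemma fmod_iso_tensor (A A' B B' : fmodule hp) :
  fmod_iso A A' -> fmod_iso B B' -> fmod_iso (fmod_tensor A B) (fmod_tensor A' B').
Proof.
move=> [f [fb fF]] [g [gb gF]]; exists (tensor_map f g).
split; first exact: tensor_map_bij.
move=> t /=; rewrite -Delta_natural; congr (Delta _ _ _ _).
by rewrite !tensor_map_comp; apply: eq_tensor_map => x /=; rewrite ?fF ?gF.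
Qed.

(** * The iterated isomorphisms and the limit generated by [gamma] *)

Section Iterates.
Variables (M N : lmodType R) (alpha : {linear M -> F M}) (beta : {linear N -> F N}).
Let gamma : {linear tensor M N -> F (tensor M N)} := Delta hp M N \o tensor_map alpha beta.

Fixpoint Delta_iter (i : nat) :
    {linear tensor (frob_iter hp M i) (frob_iter hp N i) -> frob_iter hp (tensor M N) i} :=
  match i return
    {linear tensor (frob_iter hp M i) (frob_iter hp N i) -> frob_iter hp (tensor M N) i} with
  | 0%N => idfun
  | i'.+1 => frob_map hp (Delta_iter i') \o Delta hp (frob_iter hp M i') (frob_iter hp N i')
  end.

Lemma Delta_iter_bij i : bijective (Delta_iter i).
Proof.
elim: i => [|i IHi] /=; first by exists idfun.
by apply: bij_comp; [exact: frob_map_bij | exact: Delta_bij].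
Qed.

Lemma Delta_iter_natural i t :
  Delta_iter i.+1 (tensor_map (frob_iter_map alpha i) (frob_iter_map beta i) t) =
  frob_iter_map gamma i (Delta_iter i t).
Proof.
elim: i t => [|i IHi] t.
  (* At stage 0 the two sides differ only by [F] of the identity. *)
  exact: (frob_map_id (f := idfun)).
exact: (frob_Delta_square IHi).
Qed.

(** The maps [j i \o E i] induce [phi] on the limit of [gamma], the maps [gen_in gamma i \o D i]
    induce [psi] on the tensor product, and the two are inverse to each other. *)
Lemma gen_fmod_tensor :
  fmod_iso (gen_fmod gamma) (fmod_tensor (gen_fmod alpha) (gen_fmod beta)).
Proof.
pose D := Delta_iter.
pose E i := sval (cid (linear_bij_inv (Delta_iter_bij i))).
have EK i : cancel (D i) (E i) /\ cancel (E i) (D i) by rewrite /E; case: cid.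
pose j i : {linear tensor (frob_iter hp M i) (frob_iter hp N i) ->
    tensor (gen_lim alpha) (gen_lim beta)} := tensor_map (gen_in alpha i) (gen_in beta i).
have jS i t : j i.+1 (tensor_map (frob_iter_map alpha i) (frob_iter_map beta i) t) = j i t.
  by apply: etrans (tensor_map_comp _ _ _ _ _) _; apply: eq_tensor_map => x; exact: (gen_in_f _ _).
have phi_compat i x : (j i.+1 \o E i.+1) (frob_iter_map gamma i x) = (j i \o E i) x.
  have [DK EK'] := EK i; have [DSK _] := EK i.+1.
  (* Writing [x] as [D i (E i x)] lets naturality of [D] stand in for naturality of [E]. *)
  by rewrite /= -{1}(EK' x) -Delta_iter_natural DSK jS.
pose phi : {linear gen_lim gamma -> tensor (gen_lim alpha) (gen_lim beta)} :=
  dl_lift (g := fun i => j i \o E i) phi_compat.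
have phiE i t : phi (gen_in gamma i (D i t)) = j i t.
  by apply: etrans (dl_liftE phi_compat _) _; have [DK _] := EK i; rewrite /= DK.
have psi_compat i x y : (gen_in gamma i.+1 \o D i.+1)
    (tens (frob_iter_map alpha i x) (frob_iter_map beta i y)) =
    (gen_in gamma i \o D i) (tens x y).
  have e := congr1 (fun t => gen_in gamma i.+1 (D i.+1 t))
    (tensor_mapE (frob_iter_map alpha i) (frob_iter_map beta i) x y).
  apply: etrans (esym e) _; apply: (etrans _ (gen_in_f gamma _)).
  by refine (congr1 (gen_in gamma i.+1) _); exact: Delta_iter_natural.
have [psi psiE] := dl_tensor_lift (g := fun i => gen_in gamma i \o D i) psi_compat.
have psi_j i t : psi (j i t) = gen_in gamma i (D i t).
  move: t; apply: (eq_tensor_linear (f := psi \o j i) (g := gen_in gamma i \o D i)) => x y.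
  by rewrite /= tensor_mapE; exact: psiE.
(* Since each [D i] is onto, elements of the limit can be taken in this form, on which [phi] is
   [j i t] and no inverse appears. *)
have ex_D z : exists i t, z = gen_in gamma i (D i t).
  have [i [x ->]] := gen_in_surj z; exists i, (E i x).
  by have [_ ->] := EK i.
exists phi; split.
  exists psi.
    by move=> z; have [i [t ->]] := ex_D z; rewrite phiE psi_j.
  apply: (eq_tensor_linear (f := phi \o psi) (g := idfun)) => z w.
  have [i [x [y [-> ->]]]] := dl_in_common z w.
  apply: etrans (congr1 phi (psiE i x y)) _; apply: etrans (phiE _ _) _.
  exact: tensor_mapE.
move=> z; have [i [t ->]] := ex_D z; rewrite phiE.
(* The right side collapses to [F (j i)] after [Delta]. Naturality brings [Delta] to the front, and
   the two factors are then compared by [gen_strE]. *)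
rewrite -[fmod_str (gen_fmod gamma)]/(gen_str gamma) gen_strE -Delta_iter_natural.
rewrite -[RHS]/((frob_map hp phi \o frob_map hp (gen_in gamma i))
  (frob_map hp (D i) (Delta hp _ _ _))).
rewrite -frob_map_comp.
rewrite -[RHS]/((frob_map hp (phi \o gen_in gamma i) \o frob_map hp (D i)) _) -frob_map_comp.
rewrite (eq_frob_map (g := j i)); last by move=> u; exact: phiE.
rewrite -Delta_natural /=; congr (Delta _ _ _ _).
apply: etrans (tensor_map_comp _ _ _ _ _) _; apply: (etrans _ (esym (tensor_map_comp _ _ _ _ _))).
by apply: eq_tensor_map => x; exact: (gen_strE _ _).
Qed.
End Iterates.
End FrobTensor.

Theorem theorem4p5 (R : comNzRingType) (p : nat) (hp : p \in [pchar R])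
  (hR : regular_ring R)
  (MM NN : fmodule hp) (hMM : F_finite MM) (hNN : F_finite NN)
  (M N : lmodType R) (hM : fin_gen M) (hN : fin_gen N)
  (alpha : {linear M -> frob hp M}) (beta : {linear N -> frob hp N})
  (halpha : generating_morphism MM alpha) (hbeta : generating_morphism NN beta) :
  [/\ bijective (Delta hp M N),
      forall (r s : R) (x : M) (y : N),
        Delta hp M N (tens (ftens hp r x) (ftens hp s y)) = ftens hp (r * s) (tens x y),
      F_finite (fmod_tensor MM NN),
      fin_gen (tensor M N)
    & generating_morphism (fmod_tensor MM NN) (Delta hp M N \o tensor_map alpha beta)].
Proof.
have hMN := fin_gen_tensor hM hN.
have hgen : generating_morphism (fmod_tensor MM NN) (Delta hp M N \o tensor_map alpha beta).
  (* The limit of [gamma] is the tensor product of the two generated limits, which the isomorphisms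
     in [halpha] and [hbeta] carry to [MM] and [NN]. *)
  exact: fmod_iso_trans (gen_fmod_tensor alpha beta) (fmod_iso_tensor halpha hbeta).
split=> //; first exact: Delta_bij.
  by move=> r s x y; exact: DeltaE.
by exists (tensor M N), (Delta hp M N \o tensor_map alpha beta).
Qed.
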